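(* Let $V$ be a finite set with a fixed cyclic order, let $|\cdot|$ be a submodular order function on the universe $U$ of all bipartitions of $V$, let $S$ be the set of all circle separations of $V$, and fix integers $m\ge1$ and $n>3$. Then $S$ contains a tree set $T=T(S)$ that efficiently distinguishes all distinguishable tangles of $S$. Moreover, $T$ can be chosen canonically, i.e. so that for every automorphism $\alpha$ of $S$ we have $T(S^\alpha)=T(S)^\alpha$.
   Context: The universe of bipartitions of $V$ consists of ordered pairs $(A,B)$ with $A\cup B=V$, $A\cap B=\emptyset$, involution $(A,B)^*=(B,A)$, order $(A,B)\le(C,D)$ iff $A\subseteq C$, join $(A\cup C,B\cap D)$, meet $(A\cap C,B\cup D)$. An order function assigns to each $(A,B)$ a non-negative real $|(A,B)|=|(B,A)|$; it is submodular if $|\vec r|+|\vec s|\ge|\vec r\vee\vec s|+|\vec r\wedge\vec s|$ for all $\vec r,\vec s$. A circle separation is a bipartition $(A,B)$ into two intervals of the cyclic order; $S_k$ is the set of circle separations of order $<k$. Separations are nested if they have comparable orientations. A separation $\vec r$ is trivial (in $S$) if there is $s\in S$ with $\vec r<\vec s$ and $\vec r<\overleftarrow s$; a tree set is a nested set of non-trivial separations. An orientation of $S_k$ is consistent if it has no $\vec r,\vec s$ with $\overleftarrow r<\vec s$. A $k$-tangle in $S$ is a consistent orientation of $S_k$ (one orientation of each element) having no subset in $\mathcal F=\{F\subseteq\vec U : |\bigcap_{(A,B)\in F}B|<m,\ |F|<n\}$; a tangle is a $k$-tangle for some $k$. Two tangles are distinguishable if neither is a subset of the other; a separation distinguishes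 them if they orient it differently, efficiently if it has minimal order among all separations in $S$ distinguishing them. An automorphism of $S$ is a bijection of the oriented circle separations preserving the partial order, the involution and the order function; $S^\alpha$ and $T^\alpha$ denote images under $\alpha$. *)

(* Defs.v *)
From HB Require Import structures.
From mathcomp Require Import all_boot all_order all_algebra.
From mathcomp Require Import reals.

Set Implicit Arguments.
Unset Strict Implicit.
Unset Printing Implicit Defensive.

Import Order.TTheory GRing.Theory Num.Theory.
Local Open Scope ring_scope.

Record bipartition (V : finType) := Bipartition {
  bip_sides : {set V} * {set V};
  _ : (bip_sides.1 :|: bip_sides.2 == setT)
      && (bip_sides.1 :&: bip_sides.2 == set0)
}.

HB.instance Definition _ (V : finType) := [isSub for @bip_sides V].
HB.instance Definition _ (V : finType) := [Finite of bipartition V by <:].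

Definition side1 (V : finType) (r : bipartition V) : {set V} := (bip_sides r).1.
Definition side2 (V : finType) (r : bipartition V) : {set V} := (bip_sides r).2.

Section Universe.
Variable V : finType.
Implicit Types r s t : bipartition V.

Lemma sidesU r : side1 r :|: side2 r = setT.
Proof. by case: r => p Hp; case/andP: (Hp) => /eqP. Qed.

Lemma sidesI r : side1 r :&: side2 r = set0.
Proof. by case: r => p Hp; case/andP: (Hp) => _ /eqP. Qed.

Lemma side2E r : side2 r = ~: side1 r.
Proof.
apply/setP => x; have := in_setT x; have := in_set0 x.
by rewrite -(sidesU r) -(sidesI r) !inE; case: (x \in side1 r); case: (x \in side2 r).
Qed.

Lemma bip_inj r s : side1 r = side1 s -> r = s.
Proof.
move=> e; have e2 : side2 r = side2 s by rewrite !side2E e.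
by apply: val_inj; rewrite /= [LHS]surjective_pairing [RHS]surjective_pairing;
  congr pair.
Qed.

Fact bip_inv_subproof r :
  (side2 r :|: side1 r == setT) && (side2 r :&: side1 r == set0).
Proof. by rewrite setUC sidesU setIC sidesI !eqxx. Qed.

Definition bip_inv r : bipartition V :=
  @Bipartition V (side2 r, side1 r) (bip_inv_subproof r).

Fact bip_join_subproof r s :
  ((side1 r :|: side1 s) :|: (side2 r :&: side2 s) == setT)
  && ((side1 r :|: side1 s) :&: (side2 r :&: side2 s) == set0).
Proof. by rewrite !side2E -setCU setUCr setICr !eqxx. Qed.

Definition bip_join r s : bipartition V :=
  @Bipartition V (side1 r :|: side1 s, side2 r :&: side2 s)
    (bip_join_subproof r s).

Fact bip_meet_subproof r s :
  ((side1 r :&: side1 s) :|: (side2 r :|: side2 s) == setT)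
  && ((side1 r :&: side1 s) :&: (side2 r :|: side2 s) == set0).
Proof. by rewrite !side2E -setCI setUCr setICr !eqxx. Qed.

Definition bip_meet r s : bipartition V :=
  @Bipartition V (side1 r :&: side1 s, side2 r :|: side2 s)
    (bip_meet_subproof r s).

Definition bip_le r s : bool := side1 r \subset side1 s.

Fact bip_le_refl : reflexive bip_le.
Proof. by move=> r; apply: subxx. Qed.

Fact bip_le_anti : antisymmetric bip_le.
Proof. by move=> r s rs; apply/bip_inj/eqP; rewrite eqEsubset. Qed.

Fact bip_le_trans : transitive bip_le.
Proof. by move=> s r t; apply: subset_trans. Qed.

End Universe.

Fact bip_display : Order.disp_t. Proof. exact: Order.Disp tt tt. Qed.

HB.instance Definition _ (V : finType) :=
  Order.Le_isPOrder.Build bip_display (bipartition V)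
    (@bip_le_refl V) (@bip_le_anti V) (@bip_le_trans V).

Fact bip_meetP (V : finType) (r s t : bipartition V) :
  (r <= bip_meet s t)%O = (r <= s)%O && (r <= t)%O.
Proof. exact: subsetI. Qed.

Fact bip_joinP (V : finType) (r s t : bipartition V) :
  (bip_join r s <= t)%O = (r <= t)%O && (s <= t)%O.
Proof. exact: subUset. Qed.

HB.instance Definition _ (V : finType) :=
  Order.POrder_MeetJoin_isLattice.Build bip_display (bipartition V)
    (@bip_meetP V) (@bip_joinP V).

Definition order_function (R : realType) (V : finType)
    (ord : bipartition V -> R) : Prop :=
  (forall r, 0 <= ord r) /\ (forall r, ord (bip_inv r) = ord r).

Definition submodular (R : realType) (V : finType)
    (ord : bipartition V -> R) : Prop :=
  forall r s : bipartition V,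
    ord (r `|` s)%O + ord (r `&` s)%O <= ord r + ord s.

(* [cyc a b c] reads: a, b, c are distinct and, starting from a, one meets b
   before c. *)
Definition cyclic_order (V : finType) (cyc : V -> V -> V -> bool) : Prop :=
  [/\ forall a b c, cyc a b c -> cyc b c a,
      forall a b c, cyc a b c -> ~~ cyc c b a,
      forall a b c d, cyc a b c -> cyc a c d -> cyc a b d
    & forall a b c, a != b -> b != c -> a != c -> cyc a b c || cyc c b a].

Definition cyc_segment (V : finType) (cyc : V -> V -> V -> bool) (a b : V) :
    {set V} :=
  [set x | [|| x == a, x == b | cyc a x b]].

(* The empty set counts as an interval; V itself is always one, being either
   empty or the segment from a point to its predecessor. *)
Definition cyc_interval (V : finType) (cyc : V -> V -> V -> bool)
    (A : {set V}) : bool :=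
  (A == set0) || [exists a, exists b, A == cyc_segment cyc a b].

(* A set of (unoriented) separations is represented by the set of all
   orientations of its elements, a set closed under [bip_inv]. *)
Definition circle_separations (V : finType) (cyc : V -> V -> V -> bool) :
    {set bipartition V} :=
  [set r | cyc_interval cyc (side1 r) && cyc_interval cyc (side2 r)].

Definition orientations (V : finType) (r : bipartition V) :
    {set bipartition V} := [set r; bip_inv r].

Definition nested (V : finType) (r s : bipartition V) : Prop :=
  exists r' s', [/\ r' \in orientations r, s' \in orientations s
                  & (r' >=< s')%O].

Definition trivial_in (V : finType) (S : {set bipartition V})
    (r : bipartition V) : Prop :=
  exists s, [/\ s \in S, (r < s)%O & (r < bip_inv s)%O].

Definition tree_set (V : finType) (S T : {set bipartition V}) : Prop :=
  [/\ T \subset S,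
      {in T, forall r, bip_inv r \in T},
      {in T &, forall r s, nested r s}
    & {in T, forall r, ~ trivial_in S r}].

Definition below_order (R : realType) (V : finType) (ord : bipartition V -> R)
    (S : {set bipartition V}) (k : R) : {set bipartition V} :=
  [set r in S | ord r < k].

Definition orientation_of (V : finType) (S O : {set bipartition V}) : Prop :=
  O \subset S /\ {in S, forall r, #|O :&: orientations r| = 1%N}.

Definition consistent (V : finType) (O : {set bipartition V}) : Prop :=
  {in O &, forall r s, ~~ (bip_inv r < s)%O}.

(* The intersection over the empty family is V. *)
Definition forbidden (V : finType) (m n : nat) : {set {set bipartition V}} :=
  [set F : {set bipartition V} |
     (#|\bigcap_(r in F) side2 r| < m)%N && (#|F| < n)%N].

Definition k_tangle (R : realType) (V : finType) (ord : bipartition V -> R)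
    (m n : nat) (S : {set bipartition V}) (k : R)
    (tau : {set bipartition V}) : Prop :=
  [/\ orientation_of (below_order ord S k) tau,
      consistent tau
    & forall F : {set bipartition V},
        F \subset tau -> F \notin forbidden V m n].

Definition tangle (R : realType) (V : finType) (ord : bipartition V -> R)
    (m n : nat) (S tau : {set bipartition V}) : Prop :=
  exists k : R, k_tangle ord m n S k tau.

Definition distinguishable (V : finType) (tau tau' : {set bipartition V}) :
    Prop :=
  ~~ (tau \subset tau') /\ ~~ (tau' \subset tau).

Definition distinguishes (V : finType) (s : bipartition V)
    (tau tau' : {set bipartition V}) : Prop :=
  exists r r', [/\ r \in orientations s :&: tau,
                   r' \in orientations s :&: tau' & r != r'].

Definition efficiently_distinguishes (R : realType) (V : finType)
    (ord : bipartition V -> R) (S : {set bipartition V}) (s : bipartition V)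
    (tau tau' : {set bipartition V}) : Prop :=
  distinguishes s tau tau' /\
  (forall s', s' \in S -> distinguishes s' tau tau' -> ord s <= ord s').

Definition efficiently_distinguishes_tangles (R : realType) (V : finType)
    (ord : bipartition V -> R) (m n : nat) (S T : {set bipartition V}) : Prop :=
  forall tau tau' : {set bipartition V},
    tangle ord m n S tau -> tangle ord m n S tau' ->
    distinguishable tau tau' ->
    exists2 s, s \in T & efficiently_distinguishes ord S s tau tau'.

(* A bijection of S is represented by a map of the whole universe of which
   only the restriction to S matters. *)
Definition automorphism (R : realType) (V : finType) (ord : bipartition V -> R)
    (S : {set bipartition V}) (alpha : bipartition V -> bipartition V) : Prop :=
  [/\ {in S &, injective alpha} /\ alpha @: S = S,
      {in S &, forall r s, (alpha r <= alpha s)%O = (r <= s)%O},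
      {in S, forall r, alpha (bip_inv r) = bip_inv (alpha r)}
    & {in S, forall r, ord (alpha r) = ord r}].

(* Main.v *)
(* Two arcs of a circle that cross meet in four nonempty arcs, so S is closed
   under taking corners of crossing separations.  Sorting the pairs of tangles by
   the least order of a separation distinguishing them, T is built by increasing
   order.  At each order one uses the efficient distinguishers nested with the
   part N of T already built; for every pair there is one, since an efficient
   distinguisher crossing an element of N can be replaced by a corner crossing
   fewer elements of N.  Among these, T takes for every pair all those crossing
   the fewest elements of S.  They are nested with each other: if two of them
   crossed, submodularity would turn opposite corners into further candidates,
   while opposite corners together cross strictly fewer elements of S than the
   two separations did.  No choice was made, so T is canonical; an automorphism
   of S permutes the singletons, hence comes from a permutation of V, and so maps
   tangles to tangles. *)

Require Import Defs.
From mathcomp Require Import all_boot all_order all_algebra.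
From mathcomp Require Import boolp reals.
From mathcomp Require Import zify lra.

Set Implicit Arguments.
Unset Strict Implicit.
Unset Printing Implicit Defensive.

Import Order.TTheory GRing.Theory Num.Theory.

(** * Cyclic orders: cutting the circle open, and intervals as convex sets *)

Definition cyc_nat (i j k : nat) : bool :=
  [|| (i < j < k), (j < k < i) | (k < i < j)].

Lemma cyc_nat_total i j k : i != j -> j != k -> i != k -> cyc_nat i j k || cyc_nat k j i.
Proof.
by rewrite /cyc_nat; case: (ltngtP i j); case: (ltngtP j k); case: (ltngtP i k).
Qed.

Lemma cyc_nat_sorted i j k : i <= k -> cyc_nat i j k = (i < j < k).
Proof. by rewrite /cyc_nat [k < i]ltnNge => ->; rewrite !andbF !orbF. Qed.

Lemma cyc_nat_peak i j k : i < j -> k < j -> cyc_nat i j k -> k < i.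
Proof. by rewrite /cyc_nat [j < k]ltnNge => -> /ltnW->; rewrite andbF /= => /andP[]. Qed.

Section CyclicOrder.
Variables (V : finType) (cyc : V -> V -> V -> bool).
Hypothesis Hcyc : cyclic_order cyc.
Implicit Types (a b x y z w : V) (A C : {set V}).

Lemma cyc_rot x y z : cyc x y z -> cyc y z x.
Proof. by case: Hcyc => + _ _ _; apply. Qed.

Lemma cyc_asym x y z : cyc x y z -> cyc z y x = false.
Proof. by case: Hcyc => _ H _ _ /H /negbTE. Qed.

Lemma cyc_trans x y z w : cyc x y z -> cyc x z w -> cyc x y w.
Proof. by case: Hcyc => _ _ H _; apply: H. Qed.

Lemma cyc_total x y z : x != y -> y != z -> x != z -> cyc x y z || cyc z y x.
Proof. by case: Hcyc => _ _ _; apply. Qed.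

Lemma cyc_xyx x y : cyc x y x = false.
Proof. by apply/negP => h; have := cyc_asym h; rewrite h. Qed.

Lemma cyc_xxy x y : cyc x x y = false.
Proof. by apply/negP => /cyc_rot; rewrite cyc_xyx. Qed.

Lemma cyc_xyy x y : cyc x y y = false.
Proof. by apply/negP => /cyc_rot /cyc_rot; rewrite cyc_xyx. Qed.

(** The linear order obtained by cutting the circle just before [a], so that [a] comes first. *)
Definition from_lt a x y := (x == a) && (y != a) || cyc a x y.

Lemma from_lt_irr a x : from_lt a x x = false.
Proof. by rewrite /from_lt andbN cyc_xyy. Qed.

Lemma from_lt_trans a x y z : from_lt a x y -> from_lt a y z -> from_lt a x z.
Proof.
rewrite /from_lt => /orP[/andP[/eqP-> ya]|xy] /orP[/andP[/eqP ea za]|yz].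
- by rewrite eqxx za.
- by rewrite eqxx /=; have [za|] := eqVneq z a; first by rewrite za cyc_xyx in yz.
- by move: xy; rewrite ea cyc_xyx.
- by rewrite (cyc_trans xy yz) orbT.
Qed.

Lemma from_lt_total a x y : x != y -> from_lt a x y || from_lt a y x.
Proof.
rewrite /from_lt; case: (eqVneq x a) => [->|xa]; case: (eqVneq y a) => [->|ya] //=.
  by rewrite orbT.
move=> xy; have : cyc a x y || cyc y x a by apply: cyc_total; rewrite // eq_sym.
by case/orP => [->//|/cyc_rot/cyc_rot->]; rewrite orbT.
Qed.

Lemma from_lt_cyc a x y z : from_lt a x y -> from_lt a y z -> cyc x y z.
Proof.
rewrite /from_lt => /orP[/andP[/eqP-> ya]|xy] /orP[/andP[/eqP ea za]|yz] //.
- by rewrite ea eqxx in ya.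
- by move: xy; rewrite ea cyc_xyx.
- have h1 := cyc_rot (cyc_rot xy); have h2 := cyc_rot yz.
  exact: cyc_rot (cyc_rot (cyc_trans h2 h1)).
Qed.

(** Numbering each point by how many precede it once the circle is cut at [a] turns questions about
    segments into arithmetic of naturals. *)
Lemma cyc_position a : exists p : V -> nat,
  [/\ injective p, p a = 0 & forall x y z, cyc x y z = cyc_nat (p x) (p y) (p z)].
Proof.
pose p x := #|[set y | from_lt a y x]|.
have lt x y : from_lt a x y -> p x < p y.
  move=> xy; apply: proper_card; apply/properP; split.
    by apply/subsetP => z; rewrite !inE => /from_lt_trans; apply.
  by exists x; rewrite !inE ?from_lt_irr.
have pinj : injective p.
  move=> x y exy; apply/eqP/negPn/negP => /(from_lt_total a) /orP[] /lt;
  by rewrite exy ltnn.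
have ltE x y : from_lt a x y = (p x < p y).
  apply/idP/idP => [/lt//|]; case: (eqVneq x y) => [->|]; first by rewrite ltnn.
  by move=> /(from_lt_total a) /orP[//|/lt yx xy]; have := ltn_trans xy yx; rewrite ltnn.
exists p; split => //.
  apply: eq_card0 => y; rewrite !inE /from_lt eqxx andbF /=; exact: cyc_xyx.
have sorted x y z : p x < p y < p z -> cyc x y z.
  by rewrite -!ltE => /andP[]; apply: from_lt_cyc.
move=> x y z; apply/idP/idP; last first.
  by case/or3P => /sorted // h; [apply/cyc_rot/cyc_rot|apply: cyc_rot].
(* If the positions were not in cyclic order, totality would put them in the reverse one, and
   [sorted] would then contradict asymmetry of [cyc]. *)
move=> h; apply/negPn/negP => nh.
have xy : p x != p y by apply/eqP => /pinj e; move: h; rewrite e cyc_xxy.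
have yz : p y != p z by apply/eqP => /pinj e; move: h; rewrite e cyc_xyy.
have xz : p x != p z by apply/eqP => /pinj e; move: h; rewrite e cyc_xyx.
have := cyc_nat_total xy yz xz; rewrite (negbTE nh) /=.
have zyx := cyc_asym h.
case/or3P => /sorted; first by rewrite zyx.
  by move=> /cyc_rot/cyc_rot; rewrite zyx.
by move=> /cyc_rot; rewrite zyx.
Qed.

(** Connectedness on the circle without naming end points: two points of [A] never have points
    outside [A] on both arcs between them. *)
Definition cyc_convex A : Prop := forall x y z w,
  x \in A -> y \in A -> z \notin A -> w \notin A -> cyc x z y -> cyc y w x -> False.

(** A violation consists of two interlacing pairs, one inside and one outside the set, and
    interlacing is symmetric in the two pairs. *)
Lemma cyc_convexC A : cyc_convex A -> cyc_convex (~: A).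
Proof.
move=> h x y z w; rewrite !inE !negbK => xA yA zA wA xzy ywx.
apply: (h z w y x) => //.
- exact: cyc_rot (cyc_rot (cyc_trans ywx (cyc_rot (cyc_rot xzy)))).
- exact: cyc_rot (cyc_rot (cyc_trans xzy (cyc_rot (cyc_rot ywx)))).
Qed.

Lemma cyc_convex1 x : cyc_convex [set x].
Proof. by move=> y z a b; rewrite !inE => /eqP-> /eqP->; rewrite cyc_xyx. Qed.

Lemma cyc_convex0 : cyc_convex set0.
Proof. by move=> x y z w; rewrite inE. Qed.

(** Suppose [z] and [w] outside the union separate [a] in one set from [b] in the other. The common
    point lies on one of the two arcs between [a] and [b], so [z] and [w] separate it from [a] or
    from [b], within a single convex set. *)
Lemma cyc_convexU A C x : x \in A -> x \in C ->
  cyc_convex A -> cyc_convex C -> cyc_convex (A :|: C).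
Proof.
have half A' C' a b z w q : q \in A' -> q \in C' -> cyc_convex A' -> cyc_convex C' ->
    a \in A' -> b \in C' -> z \notin A' -> z \notin C' -> w \notin A' -> w \notin C' ->
    cyc a z b -> cyc b w a -> cyc a q b -> False.
  move=> qA qC hA hC aA bC zA zC wA wC azb bwa aqb.
  have lt c d : cyc a c d -> from_lt a c d by rewrite /from_lt => ->; rewrite orbT.
  have qz : q != z by apply: contraNneq zA => <-.
  have [qa aq] : q != a /\ a != q.
    by rewrite eq_sym; have [e|] := eqVneq a q; first by rewrite e cyc_xxy in aqb.
  have az : z != a by apply: contraTneq azb => ->; rewrite cyc_xxy.
  have /orP[] := from_lt_total a qz; rewrite /from_lt (negbTE qa) (negbTE az) /= => h.
    apply: (hC q b z w) => //; first exact: from_lt_cyc (lt _ _ h) (lt _ _ azb).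
    exact: cyc_trans bwa (cyc_rot (cyc_rot aqb)).
  apply: (hA a q z w) => //; exact: cyc_rot (cyc_trans aqb (cyc_rot (cyc_rot bwa))).
have join A' C' a b z w q : q \in A' -> q \in C' -> cyc_convex A' -> cyc_convex C' ->
    a \in A' -> b \in C' -> z \notin A' -> z \notin C' -> w \notin A' -> w \notin C' ->
    cyc a z b -> cyc b w a -> False.
  move=> qA qC hA hC aA bC zA zC wA wC azb bwa.
  have [e|qa] := eqVneq q a; first by apply: (hC a b z w); rewrite // -e.
  have [e|qb] := eqVneq q b; first by apply: (hA a b z w); rewrite // -e.
  have ab : a != b by apply: contraTneq azb => ->; rewrite cyc_xyx.
  have aq : a != q by rewrite eq_sym.
  case/orP: (cyc_total aq qb ab) => h; first exact: (half A' C' a b z w q).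
  exact: (half C' A' b a w z q).
move=> xA xC hA hC a b z w; rewrite !inE !negb_or => aU bU /andP[zA zC] /andP[wA wC].
case/orP: aU => aU; case/orP: bU => bU.
- exact: hA.
- exact: (join A C a b z w x).
- exact: (join C A a b z w x).
- exact: hC.
Qed.

Lemma cyc_intervalP A : cyc_interval cyc A <-> cyc_convex A.
Proof.
split.
  case/orP => [/eqP->|/existsP[a /existsP[b /eqP->]]]; first exact: cyc_convex0.
  (* Cut at [a], the segment is an initial stretch of positions. Points [z] and [w] outside it lie
     above both [x] and [y], so [cyc_nat_peak] forces [p y < p x] and also [p x < p y]. *)
  have [p [pinj pa pE]] := cyc_position a.
  have segE x : (x \in cyc_segment cyc a b) = (p x <= p b).
    rewrite inE pE pa cyc_nat_sorted //; have [->|xa] := eqVneq x a; first by rewrite pa.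
    have x0 : 0 < p x by rewrite lt0n -pa (inj_eq pinj).
    by rewrite x0 [p x <= p b]leq_eqVlt (inj_eq pinj).
  move=> x y z w; rewrite !segE -!ltnNge !pE => xb yb zb wb h h'.
  have := cyc_nat_peak (leq_ltn_trans xb zb) (leq_ltn_trans yb zb) h.
  have := cyc_nat_peak (leq_ltn_trans yb wb) (leq_ltn_trans xb wb) h'.
  by move=> /ltnW; rewrite leqNgt => /negP.
move=> hA; rewrite /cyc_interval; case: (set_0Vmem A) => [->|[c cA]]; first by rewrite eqxx.
apply/orP; right.
(* Cutting at a point outside [A] makes [A] a stretch of consecutive positions. The default [c] is
   taken only when [A] is all of [V], and then [conv] is immediate. *)
pose w := odflt c [pick w | w \notin A].
have [p [pinj pw pE]] := cyc_position w.
have conv x y z : x \in A -> y \in A -> p x < p z < p y -> z \in A.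
  move=> xA yA xzy; apply/negPn/negP => zA.
  have wA : w \notin A.
    by move: zA; rewrite /w; case: pickP => //= e; rewrite e.
  have xw : p x != 0 by apply: contraNneq wA => e; rewrite -(pinj _ _ (etrans e (esym pw))).
  apply: (hA x y z w); rewrite // pE /cyc_nat ?xzy // pw lt0n xw /=.
  by case/andP: xzy => /ltn_trans h /h ->.
have [a aA amin] : exists2 a, a \in A & forall x, x \in A -> p a <= p x.
  by case: (arg_minnP p cA) => a aA amin; exists a.
have [b bA bmax] : exists2 b, b \in A & forall x, x \in A -> p x <= p b.
  by case: (arg_maxnP p cA) => b bA bmax; exists b.
apply/existsP; exists a; apply/existsP; exists b; apply/eqP/setP => x.
rewrite !inE pE cyc_nat_sorted ?amin //.
have [->|xa] := eqVneq x a; first by rewrite aA.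
have [->|xb] := eqVneq x b; first by rewrite bA orbT.
apply/idP/idP => [xA|]; last exact: conv.
by rewrite !ltn_neqAle amin // bmax // !(inj_eq pinj) (eq_sym a) xa xb.
Qed.

End CyclicOrder.

(** * Nestedness, corners and crossing numbers *)

Section Nestedness.
Variable V : finType.
Implicit Types r s t x : bipartition V.

Lemma bip_invK : involutive (@bip_inv V).
Proof. by move=> r; apply: bip_inj. Qed.

Lemma side1_inv r : side1 (bip_inv r) = ~: side1 r.
Proof. by rewrite -side2E. Qed.

Lemma side1_meet r s : side1 (r `&` s)%O = side1 r :&: side1 s.
Proof. by []. Qed.

Lemma bip_leE r s : (r <= s)%O = (side1 r \subset side1 s).
Proof. by []. Qed.

Lemma bip_le_inv r s : (bip_inv r <= bip_inv s)%O = (s <= r)%O.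
Proof. by rewrite !bip_leE !side1_inv setCS. Qed.

Lemma bip_inv_join r s : bip_inv (r `|` s)%O = (bip_inv r `&` bip_inv s)%O.
Proof. by apply: bip_inj. Qed.

Lemma bip_inv_meet r s : bip_inv (r `&` s)%O = (bip_inv r `|` bip_inv s)%O.
Proof. by apply: bip_inj. Qed.

(** Boolean form of [nested]. The four comparisons with [s] on the left follow from these by
    applying the involution. *)
Definition nest r s : bool :=
  [|| (r <= s)%O, (r <= bip_inv s)%O, (bip_inv r <= s)%O | (bip_inv r <= bip_inv s)%O].

Lemma nest_invl r s : nest (bip_inv r) s = nest r s.
Proof.
by rewrite /nest bip_invK; do !case: (_ <= _)%O.
Qed.

Lemma nest_invr r s : nest r (bip_inv s) = nest r s.
Proof. by rewrite /nest bip_invK; do !case: (_ <= _)%O. Qed.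

Lemma nest_sym r s : nest r s = nest s r.
Proof.
rewrite /nest -[(bip_inv s <= bip_inv r)%O]bip_le_inv -[(s <= bip_inv r)%O]bip_le_inv.
rewrite -[(bip_inv s <= r)%O]bip_le_inv -[(s <= r)%O]bip_le_inv !bip_invK.
by do !case: (_ <= _)%O.
Qed.

Lemma nestP r s : nested r s <-> nest r s.
Proof.
split.
  have cmp a b : (a >=< b)%O -> nest a b.
    by case/orP => h; [|rewrite nest_sym]; rewrite /nest h.
  move=> [a [b [/set2P[]-> /set2P[]-> /cmp]]];
  by rewrite ?nest_invl ?nest_invr.
by case/or4P => h; [exists r, s|exists r, (bip_inv s)|exists (bip_inv r), s|
  exists (bip_inv r), (bip_inv s)]; rewrite !inE !eqxx ?orbT; split => //;
  rewrite /Order.comparable h.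
Qed.

Lemma le_nest r s : (r <= s)%O -> nest r s.
Proof. by move=> h; rewrite /nest h. Qed.

(** An orientation of [x] below [r] or [s] is below the join, and one below both inverses is below
    the inverse of the join. The only other case, opposite orientations of [x] below the two
    inverses, would make [r] and [s] nested. *)
Lemma nest_corner r s x :
  ~~ nest r s -> nest x r -> nest x s -> nest x (r `|` s)%O.
Proof.
move=> rs; rewrite /nest.
have ler : (r <= r `|` s)%O by rewrite leUl.
have les : (s <= r `|` s)%O by rewrite leUr.
have low a : (a <= r)%O || (a <= s)%O -> (a <= r `|` s)%O.
  by case/orP => /le_trans; apply.
have cross a : (a <= bip_inv r)%O -> (bip_inv a <= bip_inv s)%O -> False.
  rewrite bip_le_inv => ar sa; move/negP: rs; apply.
  by rewrite nest_sym -nest_invr; apply/le_nest/(le_trans sa).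
have up a : (a <= bip_inv r)%O -> (a <= bip_inv s)%O -> (a <= bip_inv (r `|` s))%O.
  by move=> h1 h2; rewrite bip_inv_join lexI h1.
move=> /or4P[] hr /or4P[] hs;
  do ?[by rewrite (low x) ?hr ?hs ?orbT | by rewrite (low (bip_inv x)) ?hr ?hs ?orbT
      | by rewrite (up x) ?orbT | by rewrite (up (bip_inv x)) ?orbT].
  by case: (cross _ hr hs).
by case: (cross _ hr); rewrite bip_invK.
Qed.

(** An orientation of [x] below [r] lies below the join, and one below [bip_inv r] lies below the
    inverse of the meet. *)
Lemma nest_corners r s x :
  nest x r -> nest x (r `|` s)%O || nest x (r `&` s)%O.
Proof.
rewrite -[nest x (r `&` s)%O]nest_invr bip_inv_meet /nest.
by case/or4P => h; [have := le_trans h (leUl r s)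
  | have := le_trans h (leUl (bip_inv r) (bip_inv s)) | have := le_trans h (leUl r s)
  | have := le_trans h (leUl (bip_inv r) (bip_inv s))] => ->; rewrite ?orbT.
Qed.

Definition cross_number (S : {set bipartition V}) r := #|[set x in S | ~~ nest x r]|.

Lemma cross_number_inv S r : cross_number S (bip_inv r) = cross_number S r.
Proof. by apply: eq_card => x; rewrite !inE nest_invr. Qed.

(** By [nest_corner], whatever crosses one of the corners crosses [r] or [s]; by [nest_corners],
    whatever crosses both crosses [r] and [s]. The inequality is strict because [r] crosses [s] but
    neither corner. *)
Lemma cross_number_submod (S : {set bipartition V}) r s : r \in S -> ~~ nest r s ->
  cross_number S (r `|` s)%O + cross_number S (r `&` s)%O
    < cross_number S r + cross_number S s.
Proof.
move=> rS rs; rewrite /cross_number -cardsUI -[X in _ < X]cardsUI.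
have meetE x : nest x (r `&` s)%O = nest x (bip_inv r `|` bip_inv s)%O.
  by rewrite -nest_invr bip_inv_meet.
rewrite -addSn; apply: leq_add.
  apply: proper_card; apply/properP; split.
    apply/subsetP => x; rewrite !inE -!andb_orr => /andP[-> /=].
    rewrite -!negb_and; apply: contra => /andP[xr xs].
    by rewrite meetE !nest_corner ?nest_invl ?nest_invr.
  exists r; rewrite !inE rS /= ?rs ?orbT //.
  by rewrite (le_nest (leUl _ _)) nest_sym (le_nest (leIl _ _)).
apply/subset_leq_card/subsetP => x; rewrite !inE => /andP[/andP[-> nj] /andP[_ nm]] /=.
apply/andP; split; apply: contraTN isT => xr.
  by have := nest_corners s xr; rewrite (negbTE nj) (negbTE nm).
by have := nest_corners r xr; rewrite joinC meetC (negbTE nj) (negbTE nm).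
Qed.

End Nestedness.

Local Open Scope ring_scope.

(** * Tangles, efficient distinguishers and uncrossing *)

Section Efficient.
Variables (R : realType) (V : finType) (ord : bipartition V -> R) (m n : nat).
Variable S : {set bipartition V}.
Hypotheses (Hord : order_function ord) (Hsub : submodular ord).
Hypotheses (Hm : (1 <= m)%N) (Hn : (3 < n)%N).
Hypothesis Sinv : forall r, r \in S -> bip_inv r \in S.
Hypothesis Sjoin : forall r s, r \in S -> s \in S -> ~~ nest r s -> (r `|` s)%O \in S.
Implicit Types (r s x : bipartition V) (t u : {set bipartition V}).

Local Notation is_tangle := (tangle ord m n S).

Lemma ord_inv r : ord (bip_inv r) = ord r.
Proof. by case: Hord. Qed.

Lemma Smeet r s : r \in S -> s \in S -> ~~ nest r s -> (r `&` s)%O \in S.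
Proof.
move=> rS sS rs; rewrite -[(r `&` s)%O]bip_invK bip_inv_meet; apply/Sinv/Sjoin.
- exact: Sinv.
- exact: Sinv.
- by rewrite nest_invl nest_invr.
Qed.

Lemma tangle_sub t r : is_tangle t -> r \in t -> r \in S.
Proof. by case=> k [[/subsetP h _] _ _] /h; rewrite inE => /andP[]. Qed.

Lemma k_tangle_orients k t x : k_tangle ord m n S k t -> x \in S -> ord x < k ->
  x \in t \/ bip_inv x \in t.
Proof.
case=> -[_ h] _ _ xS xk; have /h /eqP : x \in below_order ord S k by rewrite inE xS.
move/cards1P => [y /setP/(_ y)]; rewrite !inE eqxx => /andP[yt /orP[]/eqP <-]; first by left.
by right.
Qed.

Lemma tangle_orients t r x : is_tangle t -> r \in t -> x \in S -> ord x <= ord r ->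
  x \in t \/ bip_inv x \in t.
Proof.
case=> k kt rt xS xr; apply: (k_tangle_orients kt xS); apply: le_lt_trans xr _.
by case: kt => -[/subsetP h _] _ _; move/h: rt; rewrite inE => /andP[].
Qed.

(** Three first sides covering [V] leave an empty intersection of second sides, of size below [m] as
    [1 <= m]; at most three separations are involved, fewer than [n] as [3 < n]. *)
Lemma tangle_no_cover t a b c : is_tangle t -> a \in t -> b \in t -> c \in t ->
  side1 a :|: side1 b :|: side1 c != setT.
Proof.
move=> [k [_ _ h]] at_ bt ct; apply: contraT; rewrite negbK => /eqP cov.
have /h : [set a; b; c] \subset t.
  by apply/subsetP => x; rewrite !inE => /orP[/orP[]|] /eqP->.
rewrite inE; case/negP; apply/andP; split; last first.
  apply: leq_ltn_trans Hn; rewrite -setUA cardsU1 cards2.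
  by case: (_ \notin _); case: (_ != _).
rewrite (_ : \bigcap_(r in _) _ = set0) ?cards0 //.
apply/setP => x; rewrite inE; apply/negP => /bigcapP hx.
have := in_setT x; rewrite -cov !inE.
have out r : r \in [set a; b; c] -> (x \in side1 r) = false.
  by move/hx; rewrite side2E inE => /negbTE.
by rewrite !out // !inE eqxx ?orbT.
Qed.

(** Otherwise [t] contains [bip_inv x], which together with [r] and [s] covers [V]. With [s] equal
    to [r] this gives closure downwards among separations of order at most [ord r]. *)
Lemma tangle_cover t r s x : is_tangle t -> r \in t -> s \in t -> x \in S ->
  ord x <= ord r -> side1 x \subset side1 r :|: side1 s -> x \in t.
Proof.
move=> tt rt st xS xr sub; case: (tangle_orients tt rt xS xr) => // xt.
case/eqP: (tangle_no_cover tt rt st xt); apply/setP => y.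
rewrite in_setU side1_inv in_setC in_setT.
by have := subsetP sub y; case: (y \in side1 x) => [->|]; rewrite ?orbT.
Qed.

Lemma tangle_notboth t r : is_tangle t -> r \in t -> bip_inv r \notin t.
Proof.
move=> tt rt; apply/negP => it; case/eqP: (tangle_no_cover tt rt rt it).
by rewrite setUid side1_inv setUCr.
Qed.

(* Oriented form of [efficiently_distinguishes]: r lies in t, its inverse in u. *)
Definition eff r t u : Prop :=
  [/\ is_tangle t, is_tangle u, r \in t, bip_inv r \in u &
      forall s, s \in t -> bip_inv s \in u -> ord r <= ord s].

Lemma eff_inv r t u : eff r t u -> eff (bip_inv r) u t.
Proof.
case=> tt tu rt ru h; split; rewrite ?bip_invK // => s su st.
by rewrite ord_inv -[ord s]ord_inv; apply: h; rewrite ?bip_invK.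
Qed.

Lemma eff_in r t u : eff r t u -> r \in S.
Proof. by case=> tt _ rt _ _; apply: tangle_sub tt rt. Qed.

Lemma eff_ord r s t u : eff r t u -> eff s t u -> ord r = ord s.
Proof.
by case=> _ _ rt ru rm [_ _ st su sm]; apply: le_anti; rewrite rm // sm.
Qed.

Lemma distinguishesP s t u : is_tangle t -> is_tangle u ->
  distinguishes s t u <-> (s \in t /\ bip_inv s \in u) \/ (bip_inv s \in t /\ s \in u).
Proof.
move=> tt tu; split.
  case=> a [b [/setIP[/set2P[]-> h1] /setIP[/set2P[]-> h2]]]; rewrite ?eqxx //; auto.
have neq w : is_tangle w -> s \in w \/ bip_inv s \in w -> s != bip_inv s.
  move=> tw [] sw; apply/eqP => e; have := tangle_notboth tw sw.
    by rewrite -e sw.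
  by rewrite -e sw.
case=> -[h1 h2]; [exists s, (bip_inv s)|exists (bip_inv s), s];
  rewrite !inE h1 h2 !eqxx ?orbT; split=> //; last rewrite eq_sym;
  by apply: (neq t) => //; auto.
Qed.

Lemma eff_efficiently r t u : eff r t u -> efficiently_distinguishes ord S r t u.
Proof.
case=> tt tu rt ru h; split; first by apply/distinguishesP; auto.
move=> s sS /(distinguishesP _ tt tu)[[]|[st su]]; first exact: h.
by rewrite -(ord_inv s); apply: h; rewrite ?bip_invK.
Qed.

Lemma eff_exists t u : is_tangle t -> is_tangle u -> distinguishable t u ->
  exists r, eff r t u.
Proof.
move=> tt tu [/subsetPn[a at_ au] /subsetPn[b bu bt]].
have [s /andP[st su]] : exists s, (s \in t) && (bip_inv s \in u).
  have [[k kt] [l lu]] := (tt, tu).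
  have bnd w j x : k_tangle ord m n S j w -> x \in w -> x \in S /\ ord x < j.
    by case=> -[/subsetP h _] _ _ /h; rewrite inE => /andP.
  have [aS ak] := bnd _ _ _ kt at_; have [bS bl] := bnd _ _ _ lu bu.
  (* The tangle of larger order orients every element of the other one, so it contains the inverse
     of the element that it lacks. *)
  case: (leP k l) => [kl|/ltW lk].
    case: (k_tangle_orients lu aS (lt_le_trans ak kl)) => [|h]; first by rewrite (negbTE au).
    by exists a; rewrite at_.
  case: (k_tangle_orients kt bS (lt_le_trans bl lk)) => [|h]; first by rewrite (negbTE bt).
  by exists (bip_inv b); rewrite h bip_invK.
case: (@arg_minP _ _ _ s [pred s | (s \in t) && (bip_inv s \in u)] ord) => [|r /andP[rt ru] rmin]; first by rewrite /= st.
exists r; split => // x xt xu; by apply: rmin; rewrite /= xt.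
Qed.

(** The join is covered by [r] and [s], hence lies in [t]; its inverse lies below [bip_inv r], hence
    in [u]. The order bound makes both tangles orient it and keeps it efficient. *)
Lemma eff_join r s t u : eff r t u -> s \in t -> ~~ nest r s ->
  ord (r `|` s)%O <= ord r -> eff (r `|` s)%O t u.
Proof.
case=> tt tu rt ru h st rs le_o.
have jS : (r `|` s)%O \in S by apply: Sjoin => //; apply: tangle_sub tt _.
have jt : (r `|` s)%O \in t by apply: (tangle_cover tt rt st).
split=> // [|x xt xu]; last exact: le_trans le_o (h _ xt xu).
apply: (tangle_cover tu ru ru); first exact: Sinv.
  by rewrite !ord_inv.
by rewrite setUid !side1_inv setCS subsetUl.
Qed.

Lemma eff_meet r s t u : eff r t u -> bip_inv s \in u -> ~~ nest r s ->
  ord (r `&` s)%O <= ord r -> eff (r `&` s)%O t u.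
Proof.
move=> /eff_inv er su rs le_o.
rewrite -[(r `&` s)%O]bip_invK bip_inv_meet; apply/eff_inv/eff_join => //.
  by rewrite nest_invl nest_invr.
by rewrite -bip_inv_meet !ord_inv.
Qed.

Lemma ord_join_ge r s t u : eff r t u -> s \in t -> ~~ nest r s ->
  ord r <= ord (r `|` s)%O.
Proof.
move=> er st rs; rewrite leNgt; apply/negP => lt_o.
by have := eff_ord er (eff_join er st rs (ltW lt_o)) => e; rewrite -e ltxx in lt_o.
Qed.

Lemma ord_meet_ge r s t u : eff r t u -> bip_inv s \in u -> ~~ nest r s ->
  ord r <= ord (r `&` s)%O.
Proof.
move=> er st rs; rewrite leNgt; apply/negP => lt_o.
by have := eff_ord er (eff_meet er st rs (ltW lt_o)) => e; rewrite -e ltxx in lt_o.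
Qed.

(* Orient r into both t and u.  If [s `|` r] and [bip_inv s `|` r] both have larger
   order than s, then [s `&` r] and [bip_inv s `&` r] have smaller order than r, so
   [u1] contains them as [t1] does; but together with [bip_inv r] they cover V. *)
Lemma uncross_lower s t u r t1 u1 : eff s t u -> eff r t1 u1 -> ord r < ord s ->
  ~~ nest r s ->
  exists s', [/\ eff s' t u, nest r s' & forall x, nest x r -> nest x s -> nest x s'].
Proof.
move=> es.
wlog rt : r t1 u1 / r \in t.
  move=> W er rs nrs; have [tt _ st _ _] := es.
  case: (tangle_orients tt st (eff_in er) (ltW rs)) => rt; first exact: (W r t1 u1).
  have [||s' [h1 h2 h3]] := W _ _ _ rt (eff_inv er); rewrite ?ord_inv ?nest_invl //.
  exists s'; split => //; first by rewrite nest_invl in h2.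
  by move=> x xr; apply: h3; rewrite nest_invr.
move=> er lt_rs nrs; have [tt tu st su smin] := es.
have nsr : ~~ nest s r by rewrite nest_sym.
have nsr' : ~~ nest s (bip_inv r) by rewrite nest_invr.
(* Otherwise [r] would distinguish [t] from [u] with smaller order than [s]. *)
have ru : r \in u.
  case: (tangle_orients tu su (eff_in er)) => //; first by rewrite ord_inv ltW.
  by move=> ru; have := smin _ rt ru; rewrite leNgt lt_rs.
have inh x y z : nest x y -> nest x z -> ~~ nest y z -> nest x (y `&` z)%O.
  move=> xy xz yz; rewrite -nest_invr bip_inv_meet.
  by apply: nest_corner; rewrite ?nest_invl ?nest_invr.
case: (leP (ord (s `|` r)%O) (ord s)) => [le1|gt1].
  exists (s `|` r)%O; split; first exact: eff_join.
    by apply/le_nest/leUr.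
  by move=> x xr xs; apply: nest_corner.
case: (leP (ord (s `&` bip_inv r)%O) (ord s)) => [le2|gt2].
  exists (s `&` bip_inv r)%O; split; first by apply: eff_meet; rewrite ?bip_invK.
    by rewrite nest_sym -nest_invr; apply/le_nest/leIr.
  by move=> x xr xs; apply: inh; rewrite ?nest_invr.
have [t1t u1t rt1 ru1 rmin] := er.
have both x : x \in S -> (x <= r)%O -> ord x < ord r -> x \in u1.
  move=> xS xr xo; have xt1 : x \in t1.
    apply: (tangle_cover t1t rt1 rt1) => //; first exact: ltW.
    by rewrite setUid -bip_leE.
  case: (tangle_orients u1t ru1 xS) => // [|xu]; first by rewrite ord_inv ltW.
  by have := rmin _ xt1 xu; rewrite leNgt xo.
have sS := eff_in es; have rS := eff_in er.
have in1 : (s `&` r)%O \in u1.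
  apply: both; [exact: Smeet|exact: leIr|].
  have := Hsub s r; lra.
have in2 : (bip_inv s `&` r)%O \in u1.
  apply: both; [|exact: leIr|].
    by apply: Smeet => //; [exact: Sinv|rewrite nest_invl].
  have := Hsub (bip_inv s) r; rewrite !ord_inv -[ord (_ `|` _)%O]ord_inv.
  rewrite bip_inv_join bip_invK; lra.
case/eqP: (tangle_no_cover u1t ru1 in1 in2); apply/setP => x.
rewrite !side1_meet !side1_inv !inE.
by case: (x \in side1 r); case: (x \in side1 s).
Qed.

(** Minimality is required only against separations inheriting nestedness from [r] and [s] jointly,
    as all corners do. This allows the choice to be restricted to separations nested with a fixed
    set. *)
Lemma minimal_crossing_nested r s t1 u1 t2 u2 :
  eff r t1 u1 -> eff s t2 u2 -> ord r = ord s ->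
  (forall r', eff r' t1 u1 -> (forall x, nest x r -> nest x s -> nest x r') ->
     (cross_number S r <= cross_number S r')%N) ->
  (forall s', eff s' t2 u2 -> (forall x, nest x r -> nest x s -> nest x s') ->
     (cross_number S s <= cross_number S s')%N) ->
  nest r s.
Proof.
move=> er es ers rmin smin; apply/negPn/negP => nrs.
have nsr : ~~ nest s r by rewrite nest_sym.
have nrs' : ~~ nest r (bip_inv s) by rewrite nest_invr.
have nsr' : ~~ nest s (bip_inv r) by rewrite nest_invr.
have inhI x y z : nest x y -> nest x z -> ~~ nest y z -> nest x (y `&` z)%O.
  move=> xy xz yz; rewrite -nest_invr bip_inv_meet.
  by apply: nest_corner; rewrite ?nest_invl ?nest_invr.
have rS := eff_in er; have sS := eff_in es.
have := cross_number_submod rS nrs; have := cross_number_submod rS nrs'.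
rewrite cross_number_inv.
have joinE : (s `|` bip_inv r)%O = bip_inv (r `&` bip_inv s)%O.
  by rewrite bip_inv_meet bip_invK joinC.
have meetE : (s `&` bip_inv r)%O = bip_inv (r `|` bip_inv s)%O.
  by rewrite bip_inv_join bip_invK meetC.
have sub1 := Hsub r s; have sub2 := Hsub r (bip_inv s); rewrite ord_inv in sub2.
set a := (r `|` s)%O in sub1 *; set b := (r `&` s)%O in sub1 *.
set c := (r `|` bip_inv s)%O in sub2 meetE *; set d := (r `&` bip_inv s)%O in sub2 joinE *.
have inh_a x : nest x r -> nest x s -> nest x a by move=> *; apply: nest_corner.
have inh_b x : nest x r -> nest x s -> nest x b by move=> *; apply: inhI.
have inh_c x : nest x r -> nest x s -> nest x c.
  by move=> *; apply: nest_corner; rewrite ?nest_invr.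
have inh_d x : nest x r -> nest x s -> nest x d.
  by move=> *; apply: inhI; rewrite ?nest_invr.
have [tt1 tu1 rt1 ru1 _] := er; have [tt2 tu2 st2 su2 _] := es.
(* Each of the four tangles orients the other separation, which singles out one corner. Efficiency
   gives that corner order at least [ord r], so submodularity bounds the opposite one by [ord r]; if
   the corner itself has order at most [ord r], it competes in the minimality hypothesis. *)
have t1s : [/\ ord b <= ord r & ord a <= ord r -> (cross_number S r <= cross_number S a)%N]
        \/ [/\ ord d <= ord r & ord c <= ord r -> (cross_number S r <= cross_number S c)%N].
  case: (tangle_orients tt1 rt1 sS) => [|h|h]; first by rewrite ers.
    left; split; first by have := ord_join_ge er h nrs; rewrite -/a; lra.
    by move=> le; apply: rmin => //; apply: eff_join.
  right; split; first by have := ord_join_ge er h nrs'; rewrite -/c; lra.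
  by move=> le; apply: rmin => //; apply: eff_join.
have u1s : [/\ ord a <= ord r & ord b <= ord r -> (cross_number S r <= cross_number S b)%N]
        \/ [/\ ord c <= ord r & ord d <= ord r -> (cross_number S r <= cross_number S d)%N].
  case: (tangle_orients tu1 ru1 sS) => [|h|h]; first by rewrite ord_inv ers.
    rewrite -[s]bip_invK in h.
    right; split; first by have := ord_meet_ge er h nrs'; rewrite -/d; lra.
    by move=> le; apply: rmin => //; apply: eff_meet.
  left; split; first by have := ord_meet_ge er h nrs; rewrite -/b; lra.
  by move=> le; apply: rmin => //; apply: eff_meet.
have t2s : [/\ ord b <= ord r & ord a <= ord r -> (cross_number S s <= cross_number S a)%N]
        \/ [/\ ord c <= ord r & ord d <= ord r -> (cross_number S s <= cross_number S d)%N].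
  case: (tangle_orients tt2 st2 rS) => [|h|h]; first by rewrite ers.
    left; split; first by have := ord_join_ge es h nsr; rewrite joinC -/a; lra.
    by move=> le; apply: smin => //; rewrite /a joinC; apply: eff_join; rewrite // joinC -ers.
  right; split; first by have := ord_join_ge es h nsr'; rewrite joinE ord_inv; lra.
  move=> le; rewrite -[cross_number S d]cross_number_inv -joinE; apply: smin.
    by apply: eff_join; rewrite // joinE ord_inv -ers.
  by move=> x xr xs; rewrite joinE nest_invr inh_d.
have u2s : [/\ ord a <= ord r & ord b <= ord r -> (cross_number S s <= cross_number S b)%N]
        \/ [/\ ord d <= ord r & ord c <= ord r -> (cross_number S s <= cross_number S c)%N].
  case: (tangle_orients tu2 su2 rS) => [|h|h]; first by rewrite ord_inv ers.
    rewrite -[r]bip_invK in h.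
    right; split; first by have := ord_meet_ge es h nsr'; rewrite meetE ord_inv; lra.
    move=> le; rewrite -[cross_number S c]cross_number_inv -meetE; apply: smin.
      by apply: eff_meet; rewrite // meetE ord_inv -ers.
    by move=> x xr xs; rewrite meetE nest_invr inh_c.
  left; split; first by have := ord_meet_ge es h nsr; rewrite meetC -/b; lra.
  by move=> le; apply: smin => //; rewrite /b meetC; apply: eff_meet; rewrite // meetC -ers.
(* In each combination, either one opposite pair of corners has total crossing number at least that
   of [r] and [s], or one pair forces the number of [r] below that of [s] and the other pair the
   reverse. *)
move: t1s u1s t2s u2s; clear.
by case: (_ <= _); case: (_ <= _); case: (_ <= _); case: (_ <= _); lia.
Qed.

End Efficient.

(** * Action of automorphisms on tangles and efficient distinguishers *)

Section Automorphisms.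
Variables (R : realType) (V : finType) (ord : bipartition V -> R) (m n : nat).
Variable S : {set bipartition V}.
Hypothesis Sinv : forall r, r \in S -> bip_inv r \in S.
Implicit Types (r s : bipartition V) (x y : V) (t u : {set bipartition V}).

Fact bip_of_subproof (A : {set V}) : (A :|: ~: A == setT) && (A :&: ~: A == set0).
Proof. by rewrite setUCr setICr !eqxx. Qed.

Definition bip_of (A : {set V}) : bipartition V :=
  @Bipartition V (A, ~: A) (bip_of_subproof A).

Lemma side1_bip_of A : side1 (bip_of A) = A.
Proof. by []. Qed.

Lemma bip_of0_le r : (bip_of set0 <= r)%O.
Proof. by rewrite bip_leE sub0set. Qed.

Lemma bip_of1_le x r : (bip_of [set x] <= r)%O = (x \in side1 r).
Proof. by rewrite bip_leE sub1set. Qed.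

Hypotheses (S0 : bip_of set0 \in S) (S1 : forall x, bip_of [set x] \in S).

Variable alpha : bipartition V -> bipartition V.
Hypothesis Halpha : automorphism ord S alpha.

Local Notation is_tangle := (tangle ord m n S).
Local Notation eff := (eff ord m n S).

Lemma auto_inj : {in S &, injective alpha}.
Proof. by case: Halpha => -[]. Qed.

Lemma auto_imset : alpha @: S = S.
Proof. by case: Halpha => -[]. Qed.

Lemma auto_in r : r \in S -> alpha r \in S.
Proof. by move=> rS; rewrite -auto_imset imset_f. Qed.

Lemma auto_onto r : r \in S -> exists2 s, s \in S & r = alpha s.
Proof. by rewrite -{1}auto_imset => /imsetP. Qed.

Lemma auto_le r s : r \in S -> s \in S -> (alpha r <= alpha s)%O = (r <= s)%O.
Proof. by case: Halpha => _ h _ _; apply: h. Qed.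

Lemma auto_inv r : r \in S -> alpha (bip_inv r) = bip_inv (alpha r).
Proof. by case: Halpha => _ _ h _; apply: h. Qed.

Lemma auto_ord r : r \in S -> ord (alpha r) = ord r.
Proof. by case: Halpha => _ _ _; apply. Qed.

Lemma auto_mem r t : r \in S -> t \subset S -> (alpha r \in alpha @: t) = (r \in t).
Proof.
move=> rS /subsetP tS; apply/imsetP/idP => [[s st e]|rt]; last by exists r.
by rewrite (auto_inj rS (tS s st) e).
Qed.

(* An automorphism permutes the atoms [bip_of [set x]] of the poset S, hence it
   comes from a permutation of V. *)
Lemma auto_point x : exists y, alpha (bip_of [set x]) = bip_of [set y].
Proof.
have bot r : r \in S -> side1 r = set0 -> r = bip_of set0.
  by move=> _ h; apply: bip_inj; rewrite side1_bip_of.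
have [s0 s0S es0] := auto_onto S0.
have alpha0 : alpha (bip_of set0) = bip_of set0.
  apply: le_anti; rewrite bip_of0_le andbT {2}es0 auto_le //; exact: bip_of0_le.
case: (set_0Vmem (side1 (alpha (bip_of [set x])))) => [e|[y yx]].
  have /(congr1 (@side1 V)) : bip_of [set x] = bip_of set0.
    by apply: auto_inj => //; rewrite alpha0; apply: bot => //; apply: auto_in.
  by rewrite !side1_bip_of => /setP/(_ x); rewrite !inE eqxx.
(* The preimage of the singleton of [y] lies below that of [x], so it is that atom or the least
   element; the latter is fixed by [alpha]. *)
exists y; have [s sS es] := auto_onto (S1 y).
have : (s <= bip_of [set x])%O by rewrite -auto_le // -es bip_of1_le.
rewrite bip_leE side1_bip_of subset1 => /orP[]/eqP e.
  by rewrite es; congr alpha; apply: bip_inj.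
move: es; rewrite (bot _ sS e) alpha0 => /(congr1 (@side1 V)).
by rewrite !side1_bip_of => /setP/(_ y); rewrite !inE eqxx.
Qed.

Lemma auto_perm : exists p : V -> V, injective p /\
  forall r x, r \in S -> (p x \in side1 (alpha r)) = (x \in side1 r).
Proof.
have ex x : exists y, alpha (bip_of [set x]) == bip_of [set y].
  by have [y ->] := auto_point x; exists y.
pose p x := xchoose (ex x).
have pE x : alpha (bip_of [set x]) = bip_of [set p x].
  by apply/eqP; apply: (xchooseP (ex x)).
exists p; split=> [x y e|r x rS]; last by rewrite -bip_of1_le -pE auto_le // bip_of1_le.
have : bip_of [set x] = bip_of [set y] by apply: (auto_inj (S1 x) (S1 y)); rewrite !pE e.
by move/(congr1 (@side1 V)); rewrite !side1_bip_of => /set1_inj.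
Qed.

Lemma below_sub k : below_order ord S k \subset S.
Proof. by apply/subsetP => r; rewrite inE => /andP[]. Qed.

(** Orientation and consistency involve only the order, the involution and [ord]. Forbidden families
    also involve sizes of intersections in [V], which are preserved because [alpha] acts through the
    permutation of [auto_perm]. *)
Lemma tangle_auto t : is_tangle t -> is_tangle (alpha @: t).
Proof.
case=> k [[tk ori] cons forb]; have tS := subset_trans tk (below_sub k).
exists k; split.
- split.
    apply/subsetP => _ /imsetP[r rt ->]; have := subsetP tk r rt.
    by rewrite !inE => /andP[rS]; rewrite auto_in // auto_ord.
  move=> s; rewrite inE => /andP[/auto_onto[r rS ->]]; rewrite auto_ord // => rk.
  have /ori <- : r \in below_order ord S k by rewrite inE rS.
  rewrite -(card_in_imset (f := alpha) (D := t :&: orientations r)); last first.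
    by move=> a b /setIP[at_ _] /setIP[bt _]; apply: auto_inj; apply: (subsetP tS).
  apply: eq_card => a; rewrite inE; apply/andP/imsetP.
    case=> /imsetP[b bt ->]; have bS := subsetP tS b bt.
    rewrite !inE -auto_inv // => /orP[]/eqP/auto_inj e;
      by exists b; rewrite // !inE bt e ?eqxx ?orbT // Sinv.
  case=> b /setIP[bt]; rewrite !inE => br ->; rewrite imset_f //; split => //.
  by case/orP: br => /eqP->; rewrite ?auto_inv // eqxx ?orbT.
- move=> _ _ /imsetP[a at_ ->] /imsetP[b bt ->].
  have [aS bS] := (subsetP tS _ at_, subsetP tS _ bt).
  have := cons a b at_ bt; rewrite -auto_inv // !lt_neqAle auto_le ?Sinv //.
  apply: contraNN => /andP[ne ->]; rewrite andbT; apply: contraNneq ne => ->.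
  exact: eqxx.
- move=> F Ft; pose F0 := [set r in t | alpha r \in F].
  have F0S r : r \in F0 -> r \in S by rewrite inE => /andP[/(subsetP tS)].
  have FE : F = alpha @: F0.
    apply/setP => s; apply/idP/imsetP => [sF|[r]]; last by rewrite inE => /andP[_ rF] ->.
    have /imsetP[r rt e] := subsetP Ft s sF.
    by exists r; rewrite // inE rt -e.
  have : F0 \notin forbidden V m n.
    by apply: forb; apply/subsetP => r; rewrite inE => /andP[].
  have [p [pinj pE]] := auto_perm.
  rewrite !inE FE card_in_imset; last by move=> a b /F0S aS /F0S; apply: auto_inj.
  suff -> : \bigcap_(r in alpha @: F0) side2 r = p @: (\bigcap_(r in F0) side2 r).
    by rewrite card_imset.
  apply/setP => y; have [q pq qp] := injF_bij pinj.
  apply/bigcapP/imsetP => [h|[x /bigcapP h ->] _ /imsetP[r rF0 ->]]; last first.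
    by have := h r rF0; rewrite !side2E !inE pE // F0S.
  exists (q y); last by rewrite qp.
  apply/bigcapP => r rF0; have := h (alpha r) (imset_f _ rF0).
  by rewrite !side2E !inE -(pE r) ?qp // F0S.
Qed.

Lemma nest_auto r s : r \in S -> s \in S -> nest (alpha r) (alpha s) = nest r s.
Proof. by move=> rS sS; rewrite /nest -!auto_inv // !auto_le ?Sinv. Qed.

Lemma cross_number_auto r : r \in S -> cross_number S (alpha r) = cross_number S r.
Proof.
move=> rS; rewrite /cross_number.
rewrite -(card_in_imset (f := alpha) (D := [set x in S | ~~ nest x r])); last first.
  by move=> a b; rewrite !inE => /andP[aS _] /andP[bS _]; apply: auto_inj.
apply: eq_card => x; rewrite !inE; apply/andP/imsetP.
  by case=> /auto_onto[s sS ->]; rewrite nest_auto // => h; exists s; rewrite ?inE ?sS.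
by case=> s; rewrite inE => /andP[sS h] ->; rewrite auto_in ?nest_auto.
Qed.

Lemma eff_auto r t u : r \in S -> is_tangle t -> is_tangle u ->
  eff (alpha r) (alpha @: t) (alpha @: u) <-> eff r t u.
Proof.
move=> rS tt tu.
have sub w : is_tangle w -> w \subset S by case=> k [[/subset_trans h _] _ _]; apply/h/below_sub.
have [tS uS] := (sub _ tt, sub _ tu).
split=> -[_ _ rt ru h]; split; try exact: tangle_auto; try by [].
- by rewrite auto_mem in rt.
- by rewrite -auto_inv // auto_mem // Sinv in ru.
- move=> s st su; have sS := subsetP tS s st.
  rewrite -(auto_ord rS) -(auto_ord sS); apply: h; first by rewrite imset_f.
  by rewrite -auto_inv // imset_f.
- by rewrite imset_f.
- by rewrite -auto_inv // imset_f.
- move=> _ /imsetP[s st ->]; have sS := subsetP tS s st.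
  rewrite -auto_inv // auto_mem ?Sinv // => su.
  by rewrite !auto_ord // h.
Qed.

End Automorphisms.

(** * Construction of the canonical tree set by increasing order *)

Section CanonicalTree.
Variables (R : realType) (V : finType) (ord : bipartition V -> R) (m n : nat).
Variable S : {set bipartition V}.
Hypotheses (Hord : order_function ord) (Hsub : submodular ord).
Hypotheses (Hm : (1 <= m)%N) (Hn : (3 < n)%N).
Hypothesis Sinv : forall r, r \in S -> bip_inv r \in S.
Hypothesis Sjoin : forall r s, r \in S -> s \in S -> ~~ nest r s -> (r `|` s)%O \in S.
Hypotheses (S0 : bip_of set0 \in S) (S1 : forall x, bip_of [set x] \in S).
Implicit Types (r s x : bipartition V) (t u : {set bipartition V}).

Local Notation eff := (eff ord m n S).
Local Notation cross_number := (cross_number S).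

(** Replaces real orders by naturals, so that induction can run through the finitely many orders
    occurring in [S]. *)
Definition order_rank (c : R) : nat := #|[set s in S | ord s < c]|.

Lemma order_rank_lt r s : r \in S -> ord r < ord s ->
  (order_rank (ord r) < order_rank (ord s))%N.
Proof.
move=> rS rs; apply: proper_card; apply/properP; split.
  by apply/subsetP => x; rewrite !inE => /andP[-> /lt_trans]; apply.
by exists r; rewrite !inE rS ?ltxx.
Qed.

Lemma order_rank_eq r s : r \in S -> s \in S ->
  order_rank (ord r) = order_rank (ord s) -> ord r = ord s.
Proof.
move=> rS sS e; case: (ltgtP (ord r) (ord s)) => // /order_rank_lt;
by rewrite e ltnn => /(_ ltac:(done)).
Qed.

(** Uncrossing [s] with an element [a] of [N] creates no new crossing with [N]: whatever in [N] is
    nested with [s] is also nested with [a]. Thus the number of crossed elements of [N] drops. *)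
Lemma eff_nested_lower (N : {set bipartition V}) s t u :
  {in N &, forall a b, nest a b} ->
  (forall r, r \in N -> exists t1 u1, eff r t1 u1) ->
  (forall r, r \in N -> ord r < ord s) -> eff s t u ->
  exists2 s', eff s' t u & {in N, forall a, nest a s'}.
Proof.
move=> Nn Ne; have [k] := ubnP #|[set a in N | ~~ nest a s]|.
elim: k s => // k IH s; rewrite ltnS => sk Nlt es.
case: (pickP (fun a => (a \in N) && ~~ nest a s)) => [a /andP[aN nas]|none]; last first.
  by exists s => // a aN; have := none a; rewrite aN /= => /negbFE.
have [t1 [u1 ea]] := Ne a aN.
have [s' [es' as' h]] := uncross_lower Hord Hsub Hm Hn Sinv Sjoin es ea (Nlt a aN) nas.
apply: (IH s') => //; last by move=> r; rewrite (eff_ord es' es); apply: Nlt.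
apply: leq_trans sk; apply: proper_card; apply/properP; split.
  apply/subsetP => b; rewrite !inE => /andP[bN]; rewrite bN; apply: contra => bs.
  by apply: h => //; apply: Nn.
by exists a; rewrite !inE aN ?nas ?as'.
Qed.

Definition candidate (N : {set bipartition V}) r t u : Prop :=
  eff r t u /\ {in N, forall a, nest a r}.

Definition selected N (i : nat) r : Prop :=
  order_rank (ord r) = i /\ exists t u, candidate N r t u /\
    forall r', candidate N r' t u -> (cross_number r <= cross_number r')%N.

Lemma selected_nested N i r s : selected N i r -> selected N i s -> nest r s.
Proof.
move=> [ri [t1 [u1 [[er nr] rmin]]]] [si [t2 [u2 [[es ns] smin]]]].
apply: (minimal_crossing_nested Hord Hsub Hm Hn Sinv Sjoin er es).
- by apply: order_rank_eq; rewrite ?ri ?si // (eff_in er, eff_in es).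
- by move=> r' er' h; apply: rmin; split=> // a aN; apply: h; [apply: nr|apply: ns].
- by move=> r' er' h; apply: smin; split=> // a aN; apply: h; [apply: nr|apply: ns].
Qed.

(** Induction invariant: that members of [N] are efficient distinguishers of lower rank permits
    uncrossing at the next rank, and invariance of [N] under automorphisms makes the next selection
    invariant. *)
Lemma canonical_levels (i : nat) : exists N : {set bipartition V},
  [/\ {in N, forall r, exists t u, eff r t u},
      {in N &, forall r s, nest r s},
      {in N, forall r, bip_inv r \in N} /\
      {in N, forall r, (order_rank (ord r) < i)%N},
      forall alpha, automorphism ord S alpha -> {in N, forall r, alpha r \in N}
    & forall r t u, eff r t u -> (order_rank (ord r) < i)%N ->
        exists2 s, s \in N & eff s t u].
Proof.
elim: i => [|i [N [Ne Nn [Ninv Nlt] Naut Ncov]]].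
  exists set0; split=> [r|r s||alpha _ r|//]; rewrite ?inE //.
  by split=> r; rewrite inE.
pose N' := N :|: [set r | `[< selected N i r >]].
have N'P r : r \in N' -> r \in N \/ selected N i r.
  by rewrite !inE => /orP[|/asboolP]; auto.
have inN r : r \in N -> r \in N' by rewrite !inE => ->.
have inM r : selected N i r -> r \in N' by move=> h; rewrite !inE; apply/orP; right; apply/asboolP.
have N'e r : r \in N' -> exists t u, eff r t u.
  by case/N'P => [/Ne//|[_ [t [u [[er _] _]]]]]; exists t, u.
have NS r : r \in N -> r \in S by move=> /Ne[t [u /eff_in]].
exists N'; split.
- by move=> r /N'e.
- move=> r s /N'P[rN|rM] /N'P[sN|sM].
  + exact: Nn.
  + by case: sM => _ [t [u [[_ h] _]]]; apply: h.
  + by case: rM => _ [t [u [[_ h] _]]]; rewrite nest_sym; apply: h.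
  + exact: selected_nested rM sM.
- split=> r /N'P[rN|[ri [t [u [[er nr] rmin]]]]].
  + exact/inN/Ninv.
  + apply: inM; split; first by rewrite ord_inv.
    exists u, t; split; first by split; [apply: eff_inv|move=> a /nr; rewrite nest_invr].
    move=> r' [er' nr']; rewrite cross_number_inv -(cross_number_inv _ r').
    by apply: rmin; split; [apply: eff_inv|move=> a /nr'; rewrite nest_invr].
  + by apply: ltnW; rewrite ltnS Nlt.
  + by rewrite ri.
- move=> alpha Ha r /N'P[rN|[ri [t [u [[er nr] rmin]]]]].
    exact/inN/Naut.
  have rS := eff_in er; have [tt tu _ _ _] := er.
  have aut := eff_auto Sinv S0 S1 Ha.
  (* An injection of a finite set into itself is onto, so nestedness with [N] transfers in both
     directions along [alpha]. *)
  have aN : alpha @: N = N.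
    apply/eqP; rewrite eqEcard card_in_imset ?leqnn ?andbT; last first.
      by move=> a b /NS aS /NS bS; apply: (auto_inj Ha).
    by apply/subsetP => _ /imsetP[a aN ->]; apply: Naut.
  have cand s : s \in S -> candidate N (alpha s) (alpha @: t) (alpha @: u) <-> candidate N s t u.
    move=> sS; have [aut1 aut2] := aut m n s t u sS tt tu.
    split=> -[es ns]; split; [exact: aut1| |exact: aut2|].
      by move=> a aN'; rewrite -(nest_auto Sinv Ha (NS _ aN') sS); apply: (ns _ (Naut _ Ha _ aN')).
    move=> a; rewrite -aN => /imsetP[b bN ->]; by rewrite (nest_auto Sinv Ha (NS _ bN) sS); apply: ns.
  apply: inM; split; first by rewrite (auto_ord Ha).
  exists (alpha @: t), (alpha @: u); split; first by apply/(cand r rS); split.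
  move=> r' cr'; have /(auto_onto Ha)[s sS es] : r' \in S by case: cr' => /eff_in.
  rewrite es (cross_number_auto Sinv Ha) // (cross_number_auto Sinv Ha) //.
  by apply: rmin; apply/(cand s sS); rewrite -es.
- move=> r t u er; rewrite ltnS leq_eqVlt => /orP[/eqP ri|ri]; last first.
    by have [s sN es] := Ncov _ _ _ er ri; exists s => //; apply: inN.
  have [s0 es0 ns0] : exists2 s', eff s' t u & {in N, forall a, nest a s'}.
    apply: (eff_nested_lower Nn _ _ er) => [a /Ne//|a aN].
    rewrite ltNge; apply/negP => le_ra.
    have := Nlt a aN; rewrite -ri ltnNge => /negP; apply.
    apply/subset_leq_card/subsetP => x; rewrite !inE => /andP[-> /lt_le_trans]; exact.
  have c0 : `[< candidate N s0 t u >] by apply/asboolP.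
  case: (@arg_minnP _ s0 (fun s => `[< candidate N s t u >]) cross_number c0).
  move=> s /asboolP cs smin; exists s; last by case: cs.
  apply: inM; split; first by rewrite -ri; congr order_rank; apply: (eff_ord cs.1 er).
  by exists t, u; split => // r' cr'; apply: smin; apply/asboolP.
Qed.

Lemma canonical_tree : exists T : {set bipartition V},
  [/\ tree_set S T, efficiently_distinguishes_tangles ord m n S T
    & forall alpha, automorphism ord S alpha -> alpha @: T = T].
Proof.
(* A member of [S] is not counted in its own rank, so every rank is below [#|S|] and this level
   serves all pairs. *)
have [N [Ne Nn [Ninv _] Naut Ncov]] := canonical_levels #|S|.
have NS r : r \in N -> r \in S by move=> /Ne[t [u /eff_in]].
exists N; split.
- split=> //; first by apply/subsetP.
    by move=> r s rN sN; apply/nestP/Nn.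
  (* A trivial [r] has its first side inside two complementary sets, hence empty. Then [bip_inv r],
     which lies in a tangle, alone covers [V]. *)
  move=> r rN [s [_ rs rs']]; have [t [u [_ tu _ ru _]]] := Ne r rN.
  case/eqP: (tangle_no_cover Hm Hn tu ru ru ru); rewrite !setUid side1_inv.
  apply/setP => x; rewrite !inE; apply/negP => xr.
  have := subsetP (ltW rs) x xr; have := subsetP (ltW rs') x xr.
  by rewrite side1_inv inE => /negP.
- move=> t u tt tu /(eff_exists tt tu)[r er].
  have [|s sN es] := Ncov _ _ _ er; last by exists s => //; apply: (eff_efficiently Hord Hm Hn es).
  apply: proper_card; apply/properP; split; first by apply/subsetP => x; rewrite inE => /andP[].
  by exists r; rewrite ?inE ?ltxx ?andbF //; apply: eff_in er.
- move=> alpha Ha; apply/eqP; rewrite eqEcard card_in_imset ?leqnn ?andbT; last first.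
    by move=> a b /NS aS /NS bS; apply: (auto_inj Ha).
  by apply/subsetP => _ /imsetP[a aN ->]; apply: Naut.
Qed.

End CanonicalTree.

(** * Circle separations as convex bipartitions, and the theorem *)

Lemma circle_separationP (V : finType) (cyc : V -> V -> V -> bool) (r : bipartition V) :
  cyclic_order cyc -> r \in circle_separations cyc <-> cyc_convex cyc (side1 r).
Proof.
move=> Hcyc; rewrite inE side2E; split=> [/andP[/(cyc_intervalP Hcyc)]//|h].
by apply/andP; split; apply/(cyc_intervalP Hcyc) => //; apply: cyc_convexC.
Qed.

(* Since [r <= bip_inv s] fails the two arcs meet, so their union is an arc. *)
Lemma circle_separation_join (V : finType) (cyc : V -> V -> V -> bool)
    (r s : bipartition V) : cyclic_order cyc ->
  r \in circle_separations cyc -> s \in circle_separations cyc -> ~~ nest r s ->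
  (r `|` s)%O \in circle_separations cyc.
Proof.
move=> Hcyc /(circle_separationP _ Hcyc) rS /(circle_separationP _ Hcyc) sS.
case/norP=> _ /norP[rs _]; apply/(circle_separationP _ Hcyc).
move: rs; rewrite bip_leE side1_inv => /subsetPn[x xr]; rewrite inE negbK => xs.
exact: (cyc_convexU Hcyc xr xs).
Qed.

Theorem theorem20 (R : realType) (V : finType) (cyc : V -> V -> V -> bool)
    (Hcyc : cyclic_order cyc)
    (ord : bipartition V -> R) (Hord : order_function ord)
    (Hsub : submodular ord) (m n : nat) (Hm : (1 <= m)%N) (Hn : (3 < n)%N) :
  let S := circle_separations cyc in
  exists T : {set bipartition V} -> {set bipartition V},
    [/\ tree_set S (T S),
        efficiently_distinguishes_tangles ord m n S (T S)
      & forall alpha : bipartition V -> bipartition V,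
          automorphism ord S alpha ->
          T (alpha @: S) = alpha @: T S].
Proof.
move=> S.
have [||||T [T1 T2 T3]] := canonical_tree (S := S) Hord Hsub Hm Hn.
- by move=> r; rewrite !inE andbC.
- by move=> r s; apply: circle_separation_join.
- by apply/circle_separationP => //; apply: cyc_convex0.
- by move=> x; apply/circle_separationP => //; apply: cyc_convex1.
(* A constant map suffices: the equation required becomes invariance of [T] under [alpha]. *)
- by exists (fun _ => T); split=> // alpha /T3 ->.
Qed.
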